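(* Let $d\geq 1$ and let $X$ be a nonempty pure $d$-dimensional abstract simplicial complex on a finite vertex set $V$ of size $n$. For $0\leq j\leq d-1$ let $k_j$ be the minimal degree of a $j$-face of $X$, and let $\mu_j$ be the largest eigenvalue of the $j$-th upper Laplacian operator $\Delta_j^{+}$ of $X$. Then the independence number $\alpha(X)$ satisfies $$ \alpha(X) \leq \frac{\mu_0\cdots\mu_{d-1}-(k_{0}+1)(k_{1}+2)\cdots (k_{d-2}+d-1)\,k_{d-1}}{\mu_0\cdots\mu_{d-1}} \cdot n, $$ and hence the chromatic number $\chi(X)$ satisfies $$ \chi(X) \geq \frac{\mu_0\cdots\mu_{d-1}}{\mu_0\cdots\mu_{d-1}-(k_{0}+1)(k_{1}+2)\cdots (k_{d-2}+d-1)\,k_{d-1}}. $$ Here $(k_{0}+1)(k_{1}+2)\cdots (k_{d-2}+d-1)\,k_{d-1}$ means $k_{d-1}\prod_{i=0}^{d-2}(k_i+i+1)$, which is $k_0$ when $d=1$.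
   Context: An abstract simplicial complex $X$ on a finite vertex set $V$ is a collection of subsets of $V$ closed under taking subsets; its elements are called faces. The dimension of a face is its cardinality minus one; a face of dimension $j$ is a $j$-face, $X^j$ is the set of $j$-faces, and $X^0=V$ (every vertex is a $0$-face). The dimension of $X$ is the largest dimension of a face; a $d$-dimensional complex is pure if all its maximal (by inclusion) faces have dimension $d$. The degree of a $j$-face is the number of $(j+1)$-faces containing it. A subset $A\subseteq V$ is independent if no maximal face of $X$ has all its vertices in $A$. The independence number $\alpha(X)$ is the size of the largest independent set of vertices. The chromatic number $\chi(X)$ is the least integer $\chi$ such that $V$ can be partitioned into $\chi$ disjoint independent sets (equivalently, the least number of colors needed to color the vertices so that no maximal face is monochromatic). Laplacians: an oriented $j$-face is a $j$-face with an ordering of its vertices. $C^j=C^j(X,\mathbb{R})$ is the real vector space of antisymmetric functions on oriented $j$-faces, i.e. $f([v_{\pi(0)},\dots,v_{\pi(j)}])=\mathrm{sgn}(\pi) f([v_0,\dots,v_j])$ for all permutations $\pi$ of $\{0,\dots,j\}$. For $0\leq j\leq d-1$, the coboundary map $\delta_j:C^j\to C^{j+1}$ is $(\delta_j f)([v_0,\dots,v_{j+1}])=\sum_{i=0}^{j+1}(-1)^i f([v_0,\dots,\widehat{v_i},\dots,v_{j+1}])$, and the boundary map $\partial_j:C^{j+1}\to C^j$ is $(\partial_j f)([v_0,\dots,v_j])=\sum_{u\in V:\ \{u,v_0,\dots,v_j\}\in X^{j+1}} f([u,v_0,\dots,v_j])$, where the sum is over vertices $u\notin\{v_0,\dots,v_j\}$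 with this property; $\partial_j$ is the adjoint of $\delta_j$ for the inner products $\langle f,g\rangle=\sum_{F\in X^j} f([F])g([F])$ (sum over unoriented faces, each with an arbitrarily chosen orientation). The $j$-th upper Laplacian is the (self-adjoint, positive semidefinite) operator $\Delta_j^+=\partial_j\circ\delta_j$ on $C^j$. *)

(* Defs.v *)
From HB Require Import structures.
From mathcomp Require Import all_boot all_order all_fingroup all_algebra.
From mathcomp Require Import reals.
Set Implicit Arguments.
Unset Strict Implicit.
Unset Printing Implicit Defensive.
Import Order.TTheory GRing.Theory Num.Theory.
Local Open Scope ring_scope.

Definition simplicial_complex (V : finType) (X : {set {set V}}) : Prop :=
  (forall F G : {set V}, F \in X -> G \subset F -> G \in X) /\
  (forall v : V, [set v] \in X).

Definition faces (V : finType) (X : {set {set V}}) (j : nat) : {set {set V}} :=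
  [set F in X | #|F| == j.+1].

Definition maximal_face (V : finType) (X : {set {set V}}) (F : {set V}) : bool :=
  maxset (mem X) F.

(* The maximum is taken over cardinalities, i.e. dimensions shifted by one, so
   that the empty face, of dimension -1, needs no special treatment. *)
Definition has_dim (V : finType) (X : {set {set V}}) (d : nat) : Prop :=
  (\max_(F in X) #|F|)%N = d.+1.

Definition pure_of_dim (V : finType) (X : {set {set V}}) (d : nat) : Prop :=
  has_dim X d /\ (forall F : {set V}, maximal_face X F -> #|F| = d.+1).

Definition degree (V : finType) (X : {set {set V}}) (F : {set V}) : nat :=
  #|[set G in X | (F \subset G) && (#|G| == #|F|.+1)]|.

(* A degree never exceeds #|V|, so the initial value #|V| of the iterated
   minimum is irrelevant as soon as there is a j-face. *)
Definition min_degree (V : finType) (X : {set {set V}}) (j : nat) : nat :=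
  \big[minn/#|V|]_(F in faces X j) degree X F.

Definition independent (V : finType) (X : {set {set V}}) (A : {set V}) : bool :=
  [forall (F : {set V} | maximal_face X F), ~~ (F \subset A)].

Definition independence_number (V : finType) (X : {set {set V}}) : nat :=
  \max_(A : {set V} | independent X A) #|A|.

Definition coloring (V : finType) (X : {set {set V}}) (P : {set {set V}}) : bool :=
  partition P [set: V] && [forall A in P, independent X A].

(* A partition of V has at most #|V| blocks, so the initial value #|V| of the
   iterated minimum is irrelevant as soon as X has a coloring; this is the case
   when every maximal face has at least two vertices. *)
Definition chromatic_number (V : finType) (X : {set {set V}}) : nat :=
  \big[minn/#|V|]_(P : {set {set V}} | coloring X P) #|P|.

Definition oriented_face (V : finType) (X : {set {set V}}) (j : nat)
    (t : j.+1.-tuple V) : bool :=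
  uniq t && ([set v in t] \in X).

(* A function on the oriented j-faces is encoded by its extension by 0 to all
   (j+1)-tuples of vertices: C^j is the set of those f with is_cochain X f. *)
Definition is_cochain (R : realType) (V : finType) (X : {set {set V}}) (j : nat)
    (f : {ffun j.+1.-tuple V -> R^o}) : Prop :=
  (forall t : j.+1.-tuple V, ~~ oriented_face X t -> f t = 0) /\
  (forall (s : 'S_j.+1) (t : j.+1.-tuple V), oriented_face X t ->
     f [tuple tnth t (s i) | i < j.+1] = (-1) ^+ s * f t).

(* [tuple tnth t (lift i k) | k < j.+1] is t with its i-th entry removed. *)
Definition coboundary (R : realType) (V : finType) (X : {set {set V}}) (j : nat)
    (f : {ffun j.+1.-tuple V -> R^o}) : {ffun j.+2.-tuple V -> R^o} :=
  [ffun t : j.+2.-tuple V =>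
     if oriented_face X t then
       \sum_(i < j.+2) (-1) ^+ i * f [tuple tnth t (lift i k) | k < j.+1]
     else 0].

Definition boundary (R : realType) (V : finType) (X : {set {set V}}) (j : nat)
    (f : {ffun j.+2.-tuple V -> R^o}) : {ffun j.+1.-tuple V -> R^o} :=
  [ffun t : j.+1.-tuple V =>
     if oriented_face X t then
       \sum_(u : V | (u \notin t) && (u |: [set v in t] \in X)) f [tuple of u :: t]
     else 0].

Definition upper_laplacian (R : realType) (V : finType) (X : {set {set V}})
    (j : nat) (f : {ffun j.+1.-tuple V -> R^o}) : {ffun j.+1.-tuple V -> R^o} :=
  boundary X (coboundary X f).

Definition laplacian_eigenvalue (R : realType) (V : finType) (X : {set {set V}})
    (j : nat) (a : R) : Prop :=
  exists f : {ffun j.+1.-tuple V -> R^o},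
    [/\ is_cochain X f, f != 0 & upper_laplacian X f = a *: f].

Definition largest_laplacian_eigenvalue (R : realType) (V : finType)
    (X : {set {set V}}) (j : nat) (a : R) : Prop :=
  laplacian_eigenvalue X j a /\
  (forall b : R, laplacian_eigenvalue X j b -> b <= a).

(* Main.v *)
Require Import Defs.
From HB Require Import structures.
From mathcomp Require Import all_boot all_order all_fingroup all_algebra.
From mathcomp Require Import reals.
From mathcomp Require Import sesquilinear spectral complex ring lra zify.
Set Implicit Arguments.
Unset Strict Implicit.
Unset Printing Implicit Defensive.
Import Order.TTheory GRing.Theory Num.Theory.
Local Open Scope ring_scope.

(** Let A be an independent set.  For a face F contained in A, let q(F) be the
    number of vertices w outside A such that F + w is a face; for F empty this
    is n - |A|, because every vertex is a face.  The proof bounds q(F) from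
    below by downward induction on |F|.

    If |F| = d, every facet containing F has its last vertex outside A, since A
    is independent, so q(F) is the degree of F and is at least k_{d-1}.

    For |F| = s < d the inductive step is the inequality
        mu_s q(F) >= (deg F + s) m,
    where m > 0 is a lower bound for q(F + u) over the u in A such that F + u
    is a face, and at least one such u exists ([outdegree_step]).  It comes
    from a Rayleigh quotient.  Consider the edges {u, w} of the link of F with
    u in A and w outside A, let E be their number, and put on each face
    F + u + w the value 1 or -1, with a coherent orientation: this is an
    (s+1)-cochain h ([cross_cochain]).  The boundary of h has value +-c(u) on
    F + u, +-c'(w) on F + w, where c and c' are the degrees in this bipartite
    graph, and +-1 on each of the s faces obtained from F + u + w by removing a
    vertex of F.  Since the squared norm of the boundary is at most
    mu_s |h|^2 ([dot_boundary_le]),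
        sum_u c(u)^2 + sum_w c'(w)^2 + s E <= mu_s E   ([cross_sum_le]).
    If p and q count the vertices of the link inside and outside A,
    Cauchy-Schwarz turns this into E/p + E/q + s <= mu_s.  Together with
    E <= p q and p m <= E it gives
        mu_s q >= (p + q + s) E / p >= (p + q + s) m   ([bipartite_bound]),
    and p + q = deg F.

    Chaining the steps ([outdegree_ge]) yields
        n - |A| = q(empty set)
               >= (n / mu_0) ((k_0 + 1) / mu_1) ... ((k_{d-2} + d-1) / mu_{d-1}) k_{d-1},
    which is the bound on the independence number.  The bound on the chromatic
    number follows because the colour classes are independent sets covering
    the n vertices.

    The norm estimate for the boundary needs the variational characterization
    of the largest eigenvalue, obtained from the spectral theorem over the
    complex numbers ([rayleigh_mx]).  All inner products are sums over tuples,
    so every face is counted once for each of its orderings; the resulting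
    factorials cancel. *)

(** * Rayleigh quotients of symmetric operators *)

(** Over the complex numbers a real symmetric matrix is Hermitian, hence unitarily
    diagonalizable with real eigenvalues; these are then eigenvalues over the
    real field too, because an eigenvalue of a matrix with entries in a
    subfield, itself lying in the subfield, has an eigenvector there. *)
Lemma rayleigh_mx (R : rcfType) n (A : 'M[R]_n) (c : R) :
  A^T = A ->
  (forall (v : 'rV[R]_n) b, v != 0 -> v *m A = b *: v -> b <= c) ->
  forall v : 'rV[R]_n, (v *m A *m v^T) 0 0 <= c * (v *m v^T) 0 0.
Proof.
move=> symA bound v.
pose toC := real_complex R; pose M := map_mx toC A; pose u := map_mx toC v.
have conjR m k (B : 'M[R]_(m, k)) : map_mx Num.conj (map_mx toC B) = map_mx toC B.
  by apply/matrixP => i j; rewrite !mxE; apply: conjc_real.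
have hermM : M \is hermsymmx.
  by apply/is_hermitianmxP; rewrite expr0 scale1r /M map_trmx conjR symA.
set P := spectralmx M; set D := spectral_diag M.
have unitP : P \is unitarymx by apply: spectral_unitarymx.
have defM : M = map_mx Num.conj P^T *m diag_mx D *m P.
  have /hermitian_normalmx /orthomx_spectralP := hermM.
  by rewrite invmx_unitary.
have PP : P *m map_mx Num.conj P^T = 1%:M by apply/unitarymxP.
have leD k : D 0 k <= toC c.
  have /complex_realP [r Dr] : D 0 k \is Num.real.
    by have /mxOverP := hermitian_spectral_diag_real hermM; apply.
  rewrite Dr lecR.
  have : eigenvalue A r.
    suff : eigenvalue M (D 0 k) by rewrite Dr (eigenvalue_map toC).
    apply/eigenvalueP; exists (row k P).
      rewrite -row_mul -/M [in LHS]defM !mulmxA PP mul1mx row_mul row_diag_mx.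
      by rewrite -scalemxAl -rowE.
    apply/eqP => Pk0; have /matrixP/(_ k k) := PP.
    rewrite !mxE eqxx big1 => [/eqP|j _]; first by rewrite eq_sym oner_eq0.
    by have /rowP/(_ j) := Pk0; rewrite !mxE => ->; rewrite mul0r.
  by case/eigenvalueP => x xA x0; apply: bound xA.
pose w := u *m map_mx Num.conj P^T.
have wE : u *m map_mx toC v^T = w *m map_mx Num.conj w^T.
  rewrite /w trmx_mul map_mxM /= !mulmxA -[u *m _ *m _]mulmxA.
  have -> : map_mx Num.conj (map_mx Num.conj P^T)^T = P.
    by apply/matrixP => i j; rewrite !mxE conjCK.
  have /mulmx1C -> := PP.
  by rewrite mulmx1 /u map_trmx conjR.
have MwE : u *m M *m map_mx toC v^T = w *m diag_mx D *m map_mx Num.conj w^T.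
  rewrite defM /w trmx_mul map_mxM /= !mulmxA.
  have -> : map_mx Num.conj (map_mx Num.conj P^T)^T = P.
    by apply/matrixP => i j; rewrite !mxE conjCK.
  by rewrite /u map_trmx conjR.
have toCE (B : 'M[R]_1) : toC (B 0 0) = (map_mx toC B) 0 0 by rewrite mxE.
suff : toC ((v *m A *m v^T) 0 0) <= toC c * toC ((v *m v^T) 0 0).
  by rewrite -rmorphM lecR.
rewrite !toCE !map_mxM -/u -/M MwE wE !mxE mulr_sumr.
apply: ler_sum => k _; rewrite mul_mx_diag !mxE mulrAC mulrC.
by apply: ler_wpM2r => //; apply: mul_conjC_ge0.
Qed.

Definition dot (R : realType) (I : finType) (f g : {ffun I -> R^o}) : R :=
  \sum_i f i * g i.

Lemma dotC (R : realType) (I : finType) (f g : {ffun I -> R^o}) :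
  dot f g = dot g f.
Proof. by apply: eq_bigr => i _; rewrite mulrC. Qed.

Lemma dotZl (R : realType) (I : finType) (a : R) (f g : {ffun I -> R^o}) :
  dot (a *: f) g = a * dot f g.
Proof. by rewrite /dot mulr_sumr; apply: eq_bigr => i _; rewrite ffunE mulrA. Qed.

Lemma dot_ge0 (R : realType) (I : finType) (f : {ffun I -> R^o}) : 0 <= dot f f.
Proof. by apply: sumr_ge0 => i _; rewrite -expr2 sqr_ge0. Qed.

Lemma dot_gt0 (R : realType) (I : finType) (f : {ffun I -> R^o}) :
  f != 0 -> 0 < dot f f.
Proof.
move=> f0; rewrite lt_def dot_ge0 andbT; apply: contraNneq f0 => ff0.
apply/eqP/ffunP => i; rewrite ffunE; apply/eqP.
have /eqP := ff0; rewrite psumr_eq0 => [/allP/(_ i)|k _]; last first.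
  by rewrite -expr2 sqr_ge0.
by rewrite mem_index_enum => /(_ isT); rewrite /= mulf_eq0 orbb.
Qed.

(** The matrix statement transported to functions on a finite type, through the
    basis of indicator functions. *)
Lemma rayleigh (R : realType) (I : finType)
    (T : {ffun I -> R^o} -> {ffun I -> R^o}) (c : R) :
  linear T ->
  (forall f g, dot (T f) g = dot f (T g)) ->
  (forall f b, f != 0 -> T f = b *: f -> b <= c) ->
  forall f, dot (T f) f <= c * dot f f.
Proof.
move=> linT symT bound f.
pose TL : {linear {ffun I -> R^o} -> {ffun I -> R^o}} :=
  HB.pack T (GRing.isLinear.Build _ _ _ _ T linT).
pose e i : {ffun I -> R^o} := [ffun k => (k == i)%:R].
have dec (g : {ffun I -> R^o}) : g = \sum_i g i *: e i.
  apply/ffunP => k; rewrite sum_ffunE (bigD1 k) //= !ffunE eqxx.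
  rewrite [_ *: _]mulr1 big1 ?addr0 // => i ki; rewrite !ffunE eq_sym (negPf ki).
  by rewrite [LHS]mulr0.
have TE g k : T g k = \sum_i g i * T (e i) k.
  rewrite -[T]/(TL : _ -> _) {1}(dec g) linear_sum sum_ffunE.
  by apply: eq_bigr => i _; rewrite linearZ ffunE.
pose A := \matrix_(i < #|I|, k < #|I|) T (e (enum_val i)) (enum_val k).
pose vec (g : {ffun I -> R^o}) : 'rV[R]_#|I| := \row_k g (enum_val k).
have sumE (F : I -> R) : \sum_(k < #|I|) F (enum_val k) = \sum_i F i.
  by rewrite [RHS](reindex _ (onW_bij _ (enum_val_bij I))).
have vecT g : vec g *m A = vec (T g).
  apply/rowP => k; rewrite !mxE TE -sumE; apply: eq_bigr => i _.
  by rewrite !mxE.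
have dotE g h : (vec g *m (vec h)^T) 0 0 = dot g h.
  by rewrite mxE /dot -sumE; apply: eq_bigr => i _; rewrite !mxE.
have dote g i : dot g (e i) = g i.
  rewrite /dot (bigD1 i) //= ffunE eqxx mulr1 big1 ?addr0 // => k ki.
  by rewrite ffunE (negPf ki) mulr0.
have symA : A^T = A.
  by apply/matrixP => i k; rewrite !mxE -!dote symT dotC.
have := rayleigh_mx symA _ (vec f); rewrite vecT !dotE; apply=> [v b v0 vA].
pose g : {ffun I -> R^o} := [ffun i => v 0 (enum_rank i)].
have vE : v = vec g by apply/rowP => k; rewrite !mxE ffunE enum_valK.
apply: (bound g).
  apply: contra v0 => /eqP g0; rewrite vE g0.
  by apply/eqP/rowP => k; rewrite !mxE ffunE.
apply/ffunP => i; have /rowP/(_ (enum_rank i)) := vA.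
by rewrite vE vecT !mxE enum_rankK => ->; rewrite [RHS]ffunE.
Qed.

(** * Antisymmetric cochains on tuples *)

Definition permt (V : finType) m (s : 'S_m) (t : m.-tuple V) : m.-tuple V :=
  [tuple tnth t (s i) | i < m].

Lemma permtM (V : finType) m (s1 s2 : 'S_m) (t : m.-tuple V) :
  permt s1 (permt s2 t) = permt (s1 * s2)%g t.
Proof. by apply: eq_from_tnth => i; rewrite !tnth_mktuple permM. Qed.

Lemma permt1 (V : finType) m (t : m.-tuple V) : permt 1 t = t.
Proof. by apply: eq_from_tnth => i; rewrite tnth_mktuple perm1. Qed.

Lemma permt_bij (V : finType) m (s : 'S_m) : bijective (@permt V m s).
Proof.
by exists (permt s^-1%g) => t; rewrite permtM (mulVg, mulgV) permt1.
Qed.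

Lemma perm_permt (V : finType) m (s : 'S_m) (t : m.-tuple V) :
  perm_eq (permt s t) t.
Proof. by apply/tuple_permP; exists s. Qed.

Definition vset (V : finType) m (t : m.-tuple V) : {set V} := [set v in t].

Lemma vset_permt (V : finType) m (s : 'S_m) (t : m.-tuple V) :
  vset (permt s t) = vset t.
Proof. by apply/setP => v; rewrite !inE (perm_mem (perm_permt s t)). Qed.

Lemma oriented_permt (V : finType) (X : {set {set V}}) j (s : 'S_j.+1)
    (t : j.+1.-tuple V) :
  oriented_face X (permt s t) = oriented_face X t.
Proof.
by rewrite /oriented_face (perm_uniq (perm_permt s t)) -/(vset _) vset_permt.
Qed.

Lemma cochain_permt (R : realType) (V : finType) (X : {set {set V}}) j
    (f : {ffun j.+1.-tuple V -> R^o}) (s : 'S_j.+1) (t : j.+1.-tuple V) :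
  is_cochain X f -> f (permt s t) = (-1) ^+ s * f t.
Proof.
case=> f0 fs; case: (boolP (oriented_face X t)) => [tX|tX]; first exact: fs.
by rewrite (f0 t) // (f0 (permt s t)) ?oriented_permt // mulr0.
Qed.

Definition del (V : finType) m (i : 'I_m.+1) (t : m.+1.-tuple V) : m.-tuple V :=
  [tuple tnth t (lift i k) | k < m].

(** Undoes a deletion at position 0; the coboundary is expressed through [del]
    and the boundary through [add]. *)
Definition add (V : finType) m (u : V) (t : m.-tuple V) : m.+1.-tuple V :=
  [tuple of u :: t].

(** Precomposing the i-th deletion of a tuple with a permutation s gives the
    (s i)-th deletion up to the permutation found here, whose sign is then
    known from that of s. *)
Lemma lift_perm_surj m (i : 'I_m.+1) (s : 'S_m.+1) :
  exists s', s = lift_perm i (s i) s'.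
Proof.
pose s1 := (s * lift_perm (s i) i 1)%g.
have s1i : s1 i = i by rewrite permM lift_perm_id.
have inj_s k : exists l, s1 (lift i k) == lift i l.
  case: (unliftP i (s1 (lift i k))) => [l ->|]; first by exists l.
  by rewrite -{2}s1i => /perm_inj/eqP; rewrite eq_sym (negPf (neq_lift _ _)).
pose f k := xchoose (inj_s k).
have fE k : s1 (lift i k) = lift i (f k) by apply/eqP/(xchooseP (inj_s k)).
have f_inj : injective f.
  move=> k l /(congr1 (lift i)); rewrite -!fE => /perm_inj; exact: lift_inj.
exists (perm f_inj); apply: (mulIg (lift_perm (s i) i 1)).
rewrite lift_permM mulg1; apply/permP => k.
case: (unliftP i k) => [l ->|->]; last by rewrite lift_perm_id.
by rewrite lift_perm_lift [in RHS]permE -fE.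
Qed.

Lemma del_permt (V : finType) m (i : 'I_m.+1) k (s : 'S_m) (t : m.+1.-tuple V) :
  del i (permt (lift_perm i k s) t) = permt s (del k t).
Proof. by apply: eq_from_tnth => l; rewrite !tnth_mktuple lift_perm_lift. Qed.

Lemma sign_lift_perm (R : pzRingType) m (i k : 'I_m.+1) (s : 'S_m) :
  (-1) ^+ lift_perm i k s = (-1) ^+ i * (-1) ^+ k * (-1) ^+ s :> R.
Proof.
by rewrite odd_lift_perm !signr_addb signr_odd signr_odd.
Qed.

Lemma coboundary_cochain (R : realType) (V : finType) (X : {set {set V}}) j
    (f : {ffun j.+1.-tuple V -> R^o}) :
  is_cochain X f -> is_cochain X (coboundary X f).
Proof.
move=> cf; split=> [t tX|s t tX]; first by rewrite ffunE (negPf tX).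
rewrite !ffunE -/(permt s t) oriented_permt tX mulr_sumr.
rewrite [RHS](reindex_inj (@perm_inj _ s)); apply: eq_bigr => i _ /=.
have [s' ds] := lift_perm_surj i s.
rewrite -/(del i _) -/(del (s i) _) {1}ds del_permt (cochain_permt _ _ cf).
have -> : (-1) ^+ s = (-1) ^+ i * (-1) ^+ s i * (-1) ^+ s' :> R.
  by rewrite {1}ds sign_lift_perm.
rewrite !mulrA; congr (_ * _).
by rewrite [RHS]mulrAC -[_ ^+ i * _ * _]mulrA -expr2 sqrr_sign mulr1.
Qed.

Lemma add_permt (V : finType) m u (s : 'S_m) (t : m.-tuple V) :
  add u (permt s t) = permt (lift_perm ord0 ord0 s) (add u t).
Proof.
apply: eq_from_tnth => k; rewrite tnth_mktuple.
case: (unliftP ord0 k) => [l ->|->]; last by rewrite lift_perm_id !tnth0.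
by rewrite lift_perm_lift !tnthS tnth_mktuple.
Qed.

Lemma boundary_cochain (R : realType) (V : finType) (X : {set {set V}}) j
    (h : {ffun j.+2.-tuple V -> R^o}) :
  is_cochain X h -> is_cochain X (boundary X h).
Proof.
move=> ch; split=> [t tX|s t tX]; first by rewrite ffunE (negPf tX).
rewrite !ffunE -/(permt s t) oriented_permt tX mulr_sumr.
apply: eq_big => [u|u _].
  by rewrite -!/(vset _) vset_permt (perm_mem (perm_permt s t)).
rewrite -!/(add _ _) add_permt (cochain_permt _ _ ch).
by rewrite sign_lift_perm -expr2 sqrr_sign mul1r.
Qed.

Lemma vset_add (V : finType) m u (t : m.-tuple V) : vset (add u t) = u |: vset t.
Proof. by apply/setP => v; rewrite !inE. Qed.

Lemma oriented_add (V : finType) (X : {set {set V}}) j u (t : j.+1.-tuple V) :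
  oriented_face X (add u t) = [&& u \notin t, uniq t & u |: vset t \in X].
Proof. by rewrite /oriented_face -/(vset _) vset_add /= andbA. Qed.

Lemma sum_tupleS (R : nmodType) (V : finType) m (F : m.+1.-tuple V -> R) :
  \sum_t F t = \sum_u \sum_t F (add u t).
Proof.
rewrite pair_big_dep /=; apply: (reindex (fun p => add p.1 p.2)).
exists (fun t => (thead t, behead_tuple t)) => [[u t] _|t _] /=.
  by congr pair; apply: val_inj.
by rewrite [RHS]tuple_eta; apply: val_inj.
Qed.

Lemma del_add (V : finType) m u (t : m.-tuple V) : del ord0 (add u t) = t.
Proof. by apply: eq_from_tnth => k; rewrite tnth_mktuple tnthS. Qed.

(** Rotating the i-th entry to the front of a tuple multiplies an antisymmetric
    function by (-1)^i, so the j+2 terms of the coboundary contribute equally;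
    each one is the pairing with the boundary.  The factor j+2 is the ratio of
    the numbers of orderings of a (j+1)-face and of a j-face. *)
Lemma dot_coboundary (R : realType) (V : finType) (X : {set {set V}}) j
    (f : {ffun j.+1.-tuple V -> R^o}) (h : {ffun j.+2.-tuple V -> R^o}) :
  simplicial_complex X ->
  is_cochain X f -> is_cochain X h ->
  dot (coboundary X f) h = j.+2%:R * dot f (boundary X h).
Proof.
move=> [Xsub _] cf ch.
have -> : dot (coboundary X f) h =
    \sum_(i < j.+2) \sum_t (-1) ^+ i * f (del i t) * h t.
  rewrite exchange_big; apply: eq_bigr => t _ /=.
  rewrite ffunE; case: ifPn => [_|tX]; first by rewrite mulr_suml.
  by rewrite mul0r big1 // => i _; rewrite (ch.1 _ tX) mulr0.
rewrite (eq_bigr (fun=> dot f (boundary X h))) => [|i _].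
  by rewrite sumr_const card_ord mulr_natl.
(* The rotation moving position i to the front, of sign (-1)^i. *)
pose s := lift_perm i ord0 1.
rewrite (reindex _ (onW_bij _ (permt_bij V s))) /=.
rewrite (eq_bigr (fun t => f (del ord0 t) * h t)) => [|t _]; last first.
  rewrite del_permt permt1 (cochain_permt _ _ ch) sign_lift_perm odd_perm1.
  by rewrite !mulr1 mulrACA -expr2 sqrr_sign mul1r.
rewrite sum_tupleS exchange_big; apply: eq_bigr => t _ /=.
rewrite ffunE; case: ifPn => [tX|tX]; last first.
  by rewrite mulr0 big1 // => u _; rewrite del_add (cf.1 _ tX) mul0r.
rewrite (bigID (fun u => (u \notin t) && (u |: vset t \in X))) /=.
rewrite [X in _ + X]big1 ?addr0 => [|u nu].
  by rewrite mulr_sumr; apply: eq_bigr => u _; rewrite del_add.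
rewrite (ch.1 (add u t)) ?mulr0 // oriented_add.
by case/andP: tX => -> _.
Qed.

(** * The largest eigenvalue bounds the norm of the boundary *)

Lemma cochainZ (R : realType) (V : finType) (X : {set {set V}}) j (a : R)
    (f : {ffun j.+1.-tuple V -> R^o}) :
  is_cochain X f -> is_cochain X (a *: f).
Proof.
move=> [f0 fs]; split=> [t tX|s t tX]; first by rewrite ffunE f0 // scaler0.
by rewrite !ffunE fs // [LHS]mulrCA.
Qed.

Lemma coboundary_linear (R : realType) (V : finType) (X : {set {set V}}) j :
  linear (@coboundary R V X j).
Proof.
move=> a f g; apply/ffunP => t; rewrite !ffunE.
case: ifP => _; last by rewrite scaler0 addr0.
rewrite scaler_sumr -big_split; apply: eq_bigr => i _ /=.
by rewrite !ffunE mulrDr; congr (_ + _); apply: mulrCA.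
Qed.

HB.instance Definition _ (R : realType) (V : finType) (X : {set {set V}}) j :=
  GRing.isLinear.Build R {ffun j.+1.-tuple V -> R^o} {ffun j.+2.-tuple V -> R^o} _
    (@coboundary R V X j) (@coboundary_linear R V X j).

Lemma boundary_linear (R : realType) (V : finType) (X : {set {set V}}) j :
  linear (@boundary R V X j).
Proof.
move=> a f g; apply/ffunP => t; rewrite !ffunE.
case: ifP => _; last by rewrite scaler0 addr0.
rewrite scaler_sumr -big_split; apply: eq_bigr => u _ /=.
by rewrite !ffunE.
Qed.

HB.instance Definition _ (R : realType) (V : finType) (X : {set {set V}}) j :=
  GRing.isLinear.Build R {ffun j.+2.-tuple V -> R^o} {ffun j.+1.-tuple V -> R^o} _
    (@boundary R V X j) (@boundary_linear R V X j).

(** The unnormalized antisymmetrization.  It is self-adjoint on all functions,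
    which extends the Laplacian from cochains to a symmetric operator on the
    full function space, where the spectral theorem applies. *)
Definition alt (R : realType) (V : finType) (X : {set {set V}}) (j : nat)
    (f : {ffun j.+1.-tuple V -> R^o}) : {ffun j.+1.-tuple V -> R^o} :=
  [ffun t => if oriented_face X t then
               \sum_(s : 'S_j.+1) (-1) ^+ s * f (permt s t) else 0].

Lemma alt_linear (R : realType) (V : finType) (X : {set {set V}}) j :
  linear (@alt R V X j).
Proof.
move=> a f g; apply/ffunP => t; rewrite !ffunE.
case: ifP => _; last by rewrite scaler0 addr0.
rewrite scaler_sumr -big_split; apply: eq_bigr => i _ /=.
by rewrite !ffunE mulrDr; congr (_ + _); apply: mulrCA.
Qed.

HB.instance Definition _ (R : realType) (V : finType) (X : {set {set V}}) j :=
  GRing.isLinear.Build R {ffun j.+1.-tuple V -> R^o} {ffun j.+1.-tuple V -> R^o} _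
    (@alt R V X j) (@alt_linear R V X j).

Lemma alt_cochain (R : realType) (V : finType) (X : {set {set V}}) j
    (f : {ffun j.+1.-tuple V -> R^o}) : is_cochain X (alt X f).
Proof.
split=> [t tX|s t tX]; first by rewrite ffunE (negPf tX).
rewrite !ffunE -/(permt s t) oriented_permt tX mulr_sumr.
rewrite (reindex_inj (mulIg s^-1%g)); apply: eq_bigr => p _ /=.
by rewrite permtM mulgKV odd_permM odd_permV signr_addb [RHS]mulrCA mulrA.
Qed.

Lemma alt_id (R : realType) (V : finType) (X : {set {set V}}) j
    (f : {ffun j.+1.-tuple V -> R^o}) :
  is_cochain X f -> alt X f = (j.+1)`!%:R *: f.
Proof.
move=> cf; apply/ffunP => t; rewrite !ffunE.
case: ifPn => [tX|/(cf.1)->]; last by rewrite scaler0.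
rewrite (eq_bigr (fun=> f t)) => [|s _]; last first.
  by rewrite (cochain_permt _ _ cf) mulrA -expr2 sqrr_sign mul1r.
by rewrite sumr_const card_Sn scaler_nat.
Qed.

Lemma dot_alt (R : realType) (V : finType) (X : {set {set V}}) j
    (f g : {ffun j.+1.-tuple V -> R^o}) : dot (alt X f) g = dot f (alt X g).
Proof.
pose F (s : 'S_j.+1) t :=
  if oriented_face X t then (-1) ^+ s * f (permt s t) * g t else 0.
have -> : dot (alt X f) g = \sum_s \sum_t F s t.
  rewrite exchange_big; apply: eq_bigr => t _ /=; rewrite ffunE /F.
  by case: ifP => _; rewrite ?mulr_suml // mul0r big1.
have -> : dot f (alt X g) =
    \sum_(s : 'S_j.+1) \sum_t
      if oriented_face X t then f t * ((-1) ^+ s * g (permt s t)) else 0.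
  rewrite exchange_big; apply: eq_bigr => t _ /=; rewrite ffunE.
  by case: ifP => _; rewrite ?mulr_sumr // mulr0 big1.
rewrite (reindex_inj invg_inj); apply: eq_bigr => s _ /=.
rewrite (reindex _ (onW_bij _ (permt_bij V s))) /=; apply: eq_bigr => t _.
by rewrite /F oriented_permt permtM mulVg permt1 odd_permV mulrAC mulrC.
Qed.

Lemma eigenvalue_ge0 (R : realType) (V : finType) (X : {set {set V}}) j (a : R) :
  simplicial_complex X -> laplacian_eigenvalue X j a -> 0 <= a.
Proof.
move=> sX [f [cf f0 Df]].
rewrite -(pmulr_lge0 _ (dot_gt0 f0)) -dotZl -Df dotC.
rewrite -(@pmulr_rge0 _ j.+2%:R) // -dot_coboundary ?dot_ge0 //.
exact: coboundary_cochain.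
Qed.

(** The operators (boundary o coboundary) on j-cochains and
    (coboundary o boundary) on (j+1)-cochains have the same nonzero
    eigenvalues, the boundary of an eigenvector of the second being an
    eigenvector of the first.  Applying the Rayleigh bound to the second
    operator bounds the norm of a boundary directly. *)
Lemma dot_boundary_le (R : realType) (V : finType) (X : {set {set V}}) j (mu : R)
    (h : {ffun j.+2.-tuple V -> R^o}) :
  simplicial_complex X -> largest_laplacian_eigenvalue X j mu ->
  is_cochain X h ->
  j.+2%:R * dot (boundary X h) (boundary X h) <= mu * dot h h.
Proof.
move=> sX [mu_ev mu_max] ch.
pose m : R := (j.+2)`!%:R.
have m_gt0 : 0 < m by rewrite ltr0n fact_gt0.
pose T g := alt X (coboundary X (boundary X (alt X g))) : {ffun j.+2.-tuple V -> R^o}.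
have linT : linear T.
  by move=> a f g; rewrite /T !linearP.
have dT f g : dot (T f) g =
    j.+2%:R * dot (boundary X (alt X f)) (boundary X (alt X g)).
  rewrite dot_alt dot_coboundary //; last exact: alt_cochain.
  by apply: boundary_cochain; apply: alt_cochain.
have symT f g : dot (T f) g = dot f (T g) by rewrite dT dotC -dT dotC.
have TE f : is_cochain X f -> T f = m ^+ 2 *: coboundary X (boundary X f).
  move=> cf; rewrite /T (alt_id cf) !linearZ /= -/m.
  rewrite alt_id ?scalerA -?expr2 //.
  by apply: coboundary_cochain; apply: boundary_cochain.
have := rayleigh linT symT _ h.
move/(_ (m ^+ 2 * mu)); rewrite (TE _ ch) dotZl dot_coboundary //; last first.
  exact: boundary_cochain.
rewrite -[m ^+ 2 * mu * _]mulrA ler_pM2l ?exprn_gt0 //; apply=> f b f0 Tf.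
(* Eigenvectors for b > 0 lie in the image of alt, hence are cochains; the
   others are harmless since mu >= 0. *)
have [b_le0|b_gt0] := lerP b 0.
  by rewrite (le_trans b_le0) // mulr_ge0 ?(eigenvalue_ge0 sX mu_ev) // exprn_ge0 // ltW.
have cf : is_cochain X f.
  have -> : f = b^-1 *: T f by rewrite Tf scalerA mulVf ?scale1r ?gt_eqF.
  by apply: cochainZ; apply: alt_cochain.
have df : coboundary X (boundary X f) = (b / m ^+ 2) *: f.
  apply: (scalerI (lt0r_neq0 (exprn_gt0 2 m_gt0))).
  by rewrite -TE // Tf scalerA mulrCA divff ?mulr1 // lt0r_neq0 ?exprn_gt0.
rewrite mulrC -ler_pdivrMr ?exprn_gt0 //; apply: mu_max.
exists (boundary X f); split; first exact: boundary_cochain.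
  apply: contra_neq f0 => df0; move: df; rewrite df0.
  rewrite linear0.
  move/esym/eqP; rewrite scaler_eq0 => /orP[|/eqP//].
  by rewrite gt_eqF // divr_gt0 // exprn_gt0.
by rewrite /upper_laplacian df linearZ.
Qed.

(** * The test cochain of a face and a vertex set *)

(** A cochain vanishes on tuples that do not enumerate a face, so the sum may run
    over all vertices. *)
Lemma boundaryE (R : realType) (V : finType) (X : {set {set V}}) j
    (h : {ffun j.+2.-tuple V -> R^o}) (t : j.+1.-tuple V) :
  simplicial_complex X -> is_cochain X h ->
  boundary X h t = \sum_u h (add u t).
Proof.
move=> [Xsub _] [h0 _]; rewrite ffunE; case: ifPn => tX.
  rewrite [RHS](bigID (fun u => (u \notin t) && (u |: [set v in t] \in X))) /=.
  rewrite [X in _ = _ + X]big1 ?addr0 // => u nu; apply: h0.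
  by rewrite oriented_add; case/andP: tX => -> _.
rewrite big1 // => u _; apply: h0; apply: contra tX.
rewrite oriented_add => /and3P[_ ut utX]; rewrite /oriented_face ut.
by apply: Xsub utX _; apply: subsetUr.
Qed.

Lemma permt_fix (V : finType) m (s : 'S_m) (t : m.-tuple V) :
  uniq t -> permt s t = t -> s = 1%g.
Proof.
move=> ut st; apply/permP => i; rewrite perm1.
have := congr1 (fun t' => tnth t' i) st; rewrite tnth_mktuple.
by move=> /(tuple_uniqP _ ut).
Qed.

Lemma add_tnth_del (V : finType) m (i : 'I_m.+1) (t : m.+1.-tuple V) :
  add (tnth t i) (del i t) = permt (lift_perm ord0 i 1) t.
Proof.
apply: eq_from_tnth => k; rewrite tnth_mktuple.
case: (unliftP ord0 k) => [l ->|->]; last by rewrite lift_perm_id tnth0.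
by rewrite lift_perm_lift perm1 tnthS tnth_mktuple.
Qed.

(** Putting the i-th entry back at the front undoes its deletion up to a rotation
    of the first i+1 entries. *)
Lemma cochain_add_del (R : realType) (V : finType) (X : {set {set V}}) j
    (h : {ffun j.+2.-tuple V -> R^o}) (i : 'I_j.+2) (t : j.+2.-tuple V) :
  is_cochain X h -> h (add (tnth t i) (del i t)) = (-1) ^+ i * h t.
Proof.
move=> ch; rewrite add_tnth_del (cochain_permt _ _ ch) sign_lift_perm odd_perm1.
by rewrite mulr1 mul1r.
Qed.

(** An ordering of the face F + u + w, where e enumerates F.  The entries of e
    come last so that deleting w or u from the front leaves an ordering of the
    same form. *)
Definition flag_tuple (V : finType) s (e : s.-tuple V) w u : s.+2.-tuple V :=
  add w (add u e).

Definition cross_seed (R : realType) (V : finType) s (A : {set V})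
    (e : s.-tuple V) : {ffun s.+2.-tuple V -> R^o} :=
  [ffun t => \sum_(w in ~: A) \sum_(u in A) (t == flag_tuple e w u)%:R].

(** The antisymmetrization makes the orientations coherent: whenever u is in A,
    w is not and the tuple (w, u, e) enumerates a face, the value there is 1
    ([cross_flag]), and all other values follow by antisymmetry or vanish.
    This is the wedge product of the indicators of the vertices of F with the
    coboundary of the indicator of A. *)
Definition cross_cochain (R : realType) (V : finType) (X : {set {set V}}) s
    (A : {set V}) (e : s.-tuple V) : {ffun s.+2.-tuple V -> R^o} :=
  alt X (cross_seed R A e).

Lemma dot_seed (R : realType) (V : finType) s (A : {set V}) (e : s.-tuple V)
    (g : {ffun s.+2.-tuple V -> R^o}) :
  dot (cross_seed R A e) g = \sum_(w in ~: A) \sum_(u in A) g (flag_tuple e w u).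
Proof.
rewrite /dot; under eq_bigr => t _.
  rewrite ffunE mulr_suml; under eq_bigr => w _ do rewrite mulr_suml.
  over.
rewrite exchange_big; apply: eq_bigr => w _ /=.
rewrite exchange_big; apply: eq_bigr => u _ /=.
rewrite (bigD1 (flag_tuple e w u)) //= eqxx mul1r big1 ?addr0 // => t nt.
by rewrite (negPf nt) mul0r.
Qed.

Lemma cross_seed_neq0 (R : realType) (V : finType) s (A : {set V})
    (e : s.-tuple V) t :
  cross_seed R A e t != 0 ->
  exists w u, [/\ w \notin A, u \in A & t = flag_tuple e w u].
Proof.
move=> t0; case: (pickP (fun p : V * V =>
    [&& p.1 \notin A, p.2 \in A & t == flag_tuple e p.1 p.2])) => [[w u]|nex].
  by case/and3P=> wA uA /eqP tE; exists w, u.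
case/eqP: t0; rewrite ffunE big1 // => w; rewrite inE => wA.
rewrite big1 // => u uA.
by have := nex (w, u); rewrite /= wA uA /= => ->.
Qed.

Lemma cross_neq0 (R : realType) (V : finType) (X : {set {set V}}) s
    (A : {set V}) (e : s.-tuple V) t :
  cross_cochain R X A e t != 0 ->
  exists p w u, [/\ w \notin A, u \in A, oriented_face X t &
                    permt p t = flag_tuple e w u].
Proof.
rewrite ffunE; case: ifP => [tX|]; last by rewrite eqxx.
move=> t0; case: (pickP (fun p : 'S_s.+2 => cross_seed R A e (permt p t) != 0)).
  by move=> p /cross_seed_neq0[w [u [wA uA pt]]]; exists p, w, u.
move=> no; case/eqP: t0; rewrite big1 // => p _.
by have /negbFE/eqP -> := no p; rewrite mulr0.
Qed.

Lemma vset_flag (V : finType) s (e : s.-tuple V) w u :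
  vset (flag_tuple e w u) = w |: (u |: vset e).
Proof. by rewrite !vset_add. Qed.

(** Only the identity permutation contributes: w and u are recovered from the set
    of entries as its only vertex outside A and its only vertex of A not in F. *)
Lemma cross_flag (R : realType) (V : finType) (X : {set {set V}}) s
    (A : {set V}) (e : s.-tuple V) w u :
  vset e \subset A -> w \notin A -> u \in A ->
  oriented_face X (flag_tuple e w u) ->
  cross_cochain R X A e (flag_tuple e w u) = 1.
Proof.
move=> eA wA uA wuX; rewrite ffunE wuX (bigD1 1%g) //= odd_perm1 permt1 mul1r.
have /andP[uniq_wu _] := wuX.
rewrite big1 ?addr0 => [|p p1].
  rewrite ffunE (bigD1 w) ?inE //= (bigD1 u) //= eqxx !big1 ?addr0 //.
    move=> w' /andP[_ w'w]; rewrite big1 // => u' _; rewrite -val_eqE /= eqE /=.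
    by rewrite [w == w']eq_sym (negPf w'w).
  move=> u' /andP[_ u'u]; rewrite -val_eqE /= !eqseq_cons [u == u']eq_sym.
  by rewrite (negPf u'u) andbF.
have [->|/cross_seed_neq0[w' [u' [w'A u'A pE]]]] :=
  eqVneq (cross_seed R A e (permt p (flag_tuple e w u))) 0.
  by rewrite mulr0.
have /setP setE := vset_permt p (flag_tuple e w u).
rewrite pE !vset_flag in setE.
have := setE w'; rewrite !in_setU !in_set1 eqxx /= => /esym.
have /negPf -> : w' \notin vset e by apply: contra w'A; apply: (subsetP eA).
have /negPf -> : w' != u by apply: contraNneq w'A => ->.
rewrite !orbF => /eqP w'w.
have uniq_p : uniq (flag_tuple e w' u').
  by rewrite -pE (perm_uniq (perm_permt _ _)).
have := setE u'; rewrite !in_setU !in_set1 eqxx /= orbT => /esym.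
have /negPf -> : u' != w by apply: contraNneq wA => <-.
have /negPf -> : u' \notin vset e.
  by move: uniq_p; rewrite /= !inE => /and3P[_ ? _].
rewrite !orbF => /eqP u'u.
by case/eqP: p1; apply: (permt_fix uniq_wu); rewrite pE w'w u'u.
Qed.

Lemma cross_sub (R : realType) (V : finType) (X : {set {set V}}) s
    (A : {set V}) (e : s.-tuple V) t :
  cross_cochain R X A e t != 0 ->
  [/\ vset e \subset vset t, exists2 w, w \in t & w \notin A &
      exists u, [/\ u \in t, u \in A & u \notin e]].
Proof.
case/cross_neq0 => p [w [u [wA uA /andP[ut _] pE]]].
have memt v : (v \in t) = (v \in flag_tuple e w u).
  by rewrite -pE (perm_mem (perm_permt p t)).
split.
- rewrite -(vset_permt p t) pE vset_flag; apply/subsetP => v ve.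
  by rewrite !in_setU ve !orbT.
- by exists w; rewrite // memt mem_head.
- exists u; split=> //; first by rewrite memt !inE eqxx orbT.
  by move: ut; rewrite -(perm_uniq (perm_permt p t)) pE /= => /and3P[].
Qed.

Lemma del_add1 (V : finType) m w u (t : m.-tuple V) :
  del (lift ord0 ord0) (add w (add u t)) = add w t.
Proof.
apply: eq_from_tnth => k; rewrite tnth_mktuple.
by case: (unliftP ord0 k) => [l ->|->]; rewrite !(tnth_nth w).
Qed.

Lemma cross_flagE (R : realType) (V : finType) (X : {set {set V}}) s
    (A : {set V}) (e : s.-tuple V) w u :
  vset e \subset A -> w \notin A -> u \in A ->
  cross_cochain R X A e (flag_tuple e w u) =
    (oriented_face X (flag_tuple e w u))%:R.
Proof.
move=> eA wA uA; case: (boolP (oriented_face X _)) => [wuX|wuX].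
  exact: cross_flag.
by rewrite ffunE (negPf wuX).
Qed.

Lemma dot_cross (R : realType) (V : finType) (X : {set {set V}}) s
    (A : {set V}) (e : s.-tuple V) :
  vset e \subset A ->
  let h := cross_cochain R X A e in
  dot h h = (s.+2)`!%:R *
    \sum_(w in ~: A) \sum_(u in A) (oriented_face X (flag_tuple e w u))%:R.
Proof.
move=> eA h; rewrite {1}/h dot_alt alt_id; last exact: alt_cochain.
rewrite dotC dotZl dotC dot_seed; congr (_ * _); apply: eq_bigr => w; rewrite inE => wA.
by apply: eq_bigr => u uA; rewrite cross_flagE.
Qed.

(** Deleting w, respectively u, leaves the boundary of the test cochain on F + u,
    respectively on F + w, where all contributions have the same sign and
    count the neighbours of the vertex across the cut.  Deleting a vertex of F
    leaves only the contribution of that same vertex, which is 1. *)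
Lemma laplacian_cross (R : realType) (V : finType) (X : {set {set V}}) s
    (A : {set V}) (e : s.-tuple V) w u :
  simplicial_complex X -> vset e \subset A -> w \notin A -> u \in A ->
  oriented_face X (flag_tuple e w u) ->
  coboundary X (boundary X (cross_cochain R X A e)) (flag_tuple e w u) =
    \sum_(y in ~: A) (oriented_face X (flag_tuple e y u))%:R +
    \sum_(y in A) (oriented_face X (flag_tuple e w y))%:R + s%:R.
Proof.
move=> sX eA wA uA wuX; set h := cross_cochain R X A e.
have ch : is_cochain X h by apply: alt_cochain.
rewrite ffunE wuX !big_ord_recl -/(del _ _) addrA; congr (_ + _ + _).
- rewrite expr0 mul1r del_add boundaryE // (bigID (mem A)) /= big1 ?add0r.
    apply: eq_big => [y|y yA]; first by rewrite inE.
    exact: cross_flagE.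
  move=> y yA; apply/eqP/negPn/negP => /cross_sub[_ [v vt vA] _].
  case/negP: vA; move: vt; rewrite !inE => /or3P[/eqP->|/eqP->|] // ve.
  by apply: (subsetP eA); rewrite inE.
- rewrite -/(del _ _).
  rewrite del_add1.
  rewrite boundaryE // mulr_sumr (bigID (mem A)) /= addrC big1 ?add0r.
    apply: eq_bigr => y yA; rewrite -(cross_flagE R X eA wA yA).
    have := cochain_add_del (lift ord0 ord0) (flag_tuple e y w) ch.
    by rewrite del_add1 => ->.
  move=> y yA; apply/eqP; rewrite mulf_eq0; apply/orP; right.
  apply/negPn/negP => /cross_sub[_ _ [v [vt vA ve]]].
  move: vt vA; rewrite !inE (negPf ve) orbF => /orP[]/eqP->; exact/negP.
rewrite (eq_bigr (fun=> 1)) => [|k _]; first by rewrite sumr_const card_ord.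
set i := lift ord0 (lift ord0 k); set t := flag_tuple e w u.
have /andP[ut _] := wuX.
have ti_del : tnth t i \notin del i t.
  apply/tnthP => -[l]; rewrite tnth_mktuple => /(tuple_uniqP _ ut)/eqP.
  by rewrite (negPf (neq_lift i l)).
have ti_e : tnth t i \in vset e by rewrite inE !tnthS mem_tnth.
rewrite boundaryE // (bigD1 (tnth t i)) //= (cochain_add_del _ _ ch).
rewrite big1 ?addr0 => [|y yi].
  by rewrite mulrA -expr2 sqrr_sign mul1r cross_flag.
apply/eqP/negPn/negP => /cross_sub[/subsetP/(_ _ ti_e) + _ _].
by rewrite !inE eq_sym (negPf yi) (negPf ti_del).
Qed.

(** The squared norm of the boundary of h is a multiple of the pairing of h with
    the coboundary of its boundary.  As h is an antisymmetrization and
    antisymmetrization is self-adjoint, that pairing only involves the values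
    of [laplacian_cross] on the tuples (w, u, e). *)
Lemma cross_sum_le (R : realType) (V : finType) (X : {set {set V}}) s
    (A : {set V}) (e : s.-tuple V) (mu : R)
    (N := fun w u : V => (oriented_face X (flag_tuple e w u))%:R : R) :
  simplicial_complex X -> vset e \subset A ->
  largest_laplacian_eigenvalue X s mu ->
  \sum_(w in ~: A) \sum_(u in A)
     N w u * (\sum_(y in ~: A) N y u + \sum_(y in A) N w y + s%:R)
  <= mu * \sum_(w in ~: A) \sum_(u in A) N w u.
Proof.
move=> sX eA hmu; pose h := cross_cochain R X A e.
have ch : is_cochain X h by apply: alt_cochain.
have cdh : is_cochain X (coboundary X (boundary X h)).
  by apply: coboundary_cochain; apply: boundary_cochain.
have := dot_boundary_le sX hmu ch.
rewrite -dot_coboundary //; last exact: boundary_cochain.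
rewrite dotC {1}/h dot_alt (alt_id cdh) dotC dotZl dotC dot_seed dot_cross //.
rewrite mulrCA ler_pM2l ?ltr0n ?fact_gt0 // => ub; apply: le_trans ub.
rewrite le_eqVlt; apply/orP; left; apply/eqP.
apply: eq_bigr => w; rewrite inE => wA; apply: eq_bigr => u uA.
rewrite /N; have [wuX|wuX] := boolP (oriented_face X (flag_tuple e w u)).
  by rewrite mul1r laplacian_cross.
by rewrite mul0r ffunE (negPf wuX).
Qed.

(** * From the norm estimate to a vertex count *)

(** The sum of the squared deviations from the mean is nonnegative. *)
Lemma sqr_sum_le (R : realFieldType) (I : finType) (S : {set I}) (c : I -> R) :
  (\sum_(i in S) c i) ^+ 2 <= #|S|%:R * \sum_(i in S) c i ^+ 2.
Proof.
have [->|S0] := eqVneq S set0; first by rewrite !big_set0 expr0n cards0 mul0r.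
have S_gt0 : 0 < #|S|%:R :> R by rewrite ltr0n card_gt0.
set E := \sum_(i in S) c i; pose a := E / #|S|%:R.
have : 0 <= \sum_(i in S) (c i - a) ^+ 2 by apply: sumr_ge0 => i _; apply: sqr_ge0.
have -> : \sum_(i in S) (c i - a) ^+ 2 = \sum_(i in S) c i ^+ 2 - a * E.
  under eq_bigr => i _ do rewrite sqrrB -mulr_natr.
  rewrite !big_split /= sumrN sumr_const -!mulr_suml -/E -mulr_natr.
  by rewrite /a; field; rewrite gt_eqF.
by rewrite subr_ge0 /a mulrAC -expr2 ler_pdivrMr // mulrC.
Qed.

(** Writing E for the number of edges, p = #|S|, q = #|W| and c, c' for the
    degrees on both sides, the left-hand side of the hypothesis is
    sum c^2 + sum c'^2 + s E, at least E^2/p + E^2/q + s E.  Hence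
    mu q >= q E/p + E + s q, and the trivial bound E <= p q replaces the last
    q by E/p.  This is where s adds to the vertex count p + q. *)
Lemma bipartite_bound (R : realFieldType) (V : finType) (S W : {set V})
    (n : V -> V -> bool) (s : nat) (mu m : R)
    (N := fun w u : V => (n w u)%:R : R) :
  S != set0 -> 0 < m -> (forall u, u \in S -> m <= \sum_(w in W) N w u) ->
  \sum_(w in W) \sum_(u in S)
     N w u * (\sum_(y in W) N y u + \sum_(y in S) N w y + s%:R)
    <= mu * \sum_(w in W) \sum_(u in S) N w u ->
  (#|S| + #|W| + s)%:R * m <= mu * #|W|%:R.
Proof.
move=> S0 m0 le_m.
pose c u := \sum_(w in W) N w u; pose c' w := \sum_(u in S) N w u.
set E := \sum_(w in W) \sum_(u in S) N w u.
have Ec : \sum_(u in S) c u = E by rewrite /E exchange_big.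
have -> : \sum_(w in W) \sum_(u in S)
     N w u * (\sum_(y in W) N y u + \sum_(y in S) N w y + s%:R) =
   \sum_(u in S) c u ^+ 2 + \sum_(w in W) c' w ^+ 2 + s%:R * E.
  under eq_bigr => w _ do under eq_bigr => u _ do
    rewrite -/(c u) -/(c' w) !mulrDr.
  under eq_bigr => w _ do rewrite !big_split /=.
  rewrite !big_split /=; congr (_ + _ + _).
  - by rewrite exchange_big; apply: eq_bigr => u _; rewrite -mulr_suml.
  - by apply: eq_bigr => w _; rewrite -mulr_suml.
  - by rewrite mulr_sumr; apply: eq_bigr => w _; rewrite -mulr_suml mulrC.
have p0 : 0 < #|S|%:R :> R by rewrite ltr0n card_gt0.
have Epm : #|S|%:R * m <= E.
  rewrite -Ec mulr_natl -sumr_const; exact: ler_sum.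
have E0 : 0 < E by apply: lt_le_trans Epm; apply: mulr_gt0.
have Epq : E <= #|W|%:R * #|S|%:R.
  have -> : #|W|%:R * #|S|%:R = \sum_(w in W) \sum_(u in S) 1 :> R.
    by rewrite !sumr_const mulr_natl.
  by apply: ler_sum => w _; apply: ler_sum => u _; rewrite lern1 leq_b1.
have := sqr_sum_le S c; have := sqr_sum_le W c'; rewrite Ec -/E.
set Q := #|W|%:R; set P := #|S|%:R.
move: (\sum_(u in S) _) (\sum_(w in W) _) => C C' hC' hC hmu.
rewrite !natrD -/P -/Q.
have s0 : 0 <= s%:R :> R by [].
have Q0 : 0 <= Q by [].
(* Multiply the hypothesis by P Q, use both Cauchy-Schwarz bounds and E <= P Q,
   and cancel E. *)
have step : (P + Q + s%:R) * E <= mu * Q * P.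
  rewrite -(ler_pM2r E0).
  have h1 := ler_wpM2l Q0 hC; have h2 := ler_wpM2l (ltW p0) hC'.
  have h3 := ler_wpM2l (mulr_ge0 Q0 (ltW p0)) hmu.
  have h4 := ler_wpM2l (mulr_ge0 s0 (ltW E0)) Epq.
  rewrite -/P -/Q in h1 h2 h3 h4 *; nra.
rewrite -(ler_pM2r p0) -/P; apply: le_trans step.
rewrite -mulrA [m * P]mulrC; apply: ler_wpM2l => //.
by rewrite !addr_ge0 // ltW.
Qed.

Lemma sum_subset (R : nmodType) (V : finType) (A B : {set V}) (f : V -> R) :
  B \subset A -> (forall i, i \in A :\: B -> f i = 0) ->
  \sum_(i in A) f i = \sum_(i in B) f i.
Proof.
by move=> BA f0; rewrite (big_setID B) (setIidPr BA) /= [X in _ + X]big1 ?addr0.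
Qed.

Definition outdegree (V : finType) (X : {set {set V}}) (A F : {set V}) : nat :=
  #|[set w in ~: A | w |: F \in X]|.

Lemma degreeE (V : finType) (X : {set {set V}}) (F : {set V}) :
  degree X F = #|[set v in ~: F | v |: F \in X]|.
Proof.
have inj : {in [set v in ~: F | v |: F \in X] &, injective (fun v => v |: F)}.
  move=> v w; rewrite !inE => /andP[vF _] /andP[wF _] /setP/(_ v).
  by rewrite !inE eqxx (negPf vF) !orbF => /esym/eqP.
rewrite /degree -(card_in_imset inj); apply: eq_card => G.
rewrite inE; apply/and3P/imsetP => [[GX FG /eqP cG]|].
  have /cards1P[v vE] : #|G :\: F| == 1%N.
    by rewrite cardsD (setIidPr FG) cG subSnn.
  have GE : G = v |: F by rewrite -vE setUC -{1}(setID G F) (setIidPr FG).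
  have : v \in G :\: F by rewrite vE set11.
  by rewrite inE => /andP[vF _]; exists v; rewrite // !inE vF -GE.
case=> v; rewrite !inE => /andP[vF vX] ->.
by rewrite vX subsetUr cardsU1 vF.
Qed.

Lemma degree_split (V : finType) (X : {set {set V}}) (A F : {set V}) :
  F \subset A ->
  degree X F = (#|[set u in A :\: F | u |: F \in X]| + outdegree X A F)%N.
Proof.
move=> FA; rewrite degreeE -(cardsID A); congr (_ + _)%N.
  by apply: eq_card => v; rewrite !inE andbAC.
apply: eq_card => v; rewrite !inE; case: (boolP (v \in A)) => //= vA.
by rewrite (contra _ vA) // => /(subsetP FA).
Qed.

Lemma tuple_of_card (V : finType) (F : {set V}) s : #|F| = s ->
  exists e : s.-tuple V, uniq e /\ vset e = F.
Proof.
move=> <-; exists (enum_tuple (mem F)); split; first exact: enum_uniq.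
by apply/setP => v; rewrite inE mem_enum.
Qed.

(** The bipartite bound for the edges of the link of F that cross from A to its
    complement; the neighbours of u across the cut are counted by the
    outdegree of F + u. *)
Lemma outdegree_step (R : realType) (V : finType) (X : {set {set V}})
    (A F : {set V}) (mu m : R) :
  simplicial_complex X -> F \subset A ->
  largest_laplacian_eigenvalue X #|F| mu ->
  [set u in A :\: F | u |: F \in X] != set0 -> 0 < m ->
  (forall u, u \in A :\: F -> u |: F \in X ->
     m <= (outdegree X A (u |: F))%:R) ->
  (degree X F + #|F|)%:R * m <= mu * (outdegree X A F)%:R.
Proof.
move=> sX FA hmu S0 m0 hm; have [e [ue eF]] := tuple_of_card (erefl #|F|).
have memF v : (v \in e) = (v \in F) by have /setP/(_ v) := eF; rewrite inE.
rewrite (degree_split X FA); move: S0.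
set S := [set u in _ | _]; set W := [set w in ~: A | w |: F \in X] => S0.
pose n w u := oriented_face X (flag_tuple e w u).
have nE w u : u \in A :\: F -> w \notin A -> n w u = (w |: (u |: F) \in X).
  rewrite inE => /andP[uF uA] wA; rewrite /n /oriented_face -/(vset _) vset_flag eF.
  case: (_ \in X); rewrite ?andbF // andbT /= ue andbT !inE negb_or.
  rewrite !memF uF andbT; apply/andP; split.
    by apply: contraNneq wA => ->.
  by apply: contra wA; apply: (subsetP FA).
have eA : vset e \subset A by rewrite eF.
have n_out w u : w \notin A -> u \in A -> n w u -> (w \in W) && (u \in S).
  move=> wA uA wu; have uF : u \in A :\: F.
    move: wu => /andP[/= /and3P[_ ue' _] _].
    by rewrite inE uA andbT -memF.
  move: wu; rewrite nE // => wuX; rewrite inE [u \in S]inE uF inE wA /=.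
  by apply/andP; split; apply: (sX.1) wuX _; rewrite ?subsetUr // setUS // subsetUr.
have sumW (f : V -> R) u : u \in A ->
    (forall w, w \notin A -> ~~ n w u -> f w = 0) ->
    \sum_(w in ~: A) f w = \sum_(w in W) f w.
  move=> uA f0; apply: sum_subset => [|w].
    by apply/subsetP => w; rewrite !inE => /andP[].
  rewrite in_setD in_setC => /andP[wW wA]; apply: f0 => //.
  by apply: contra wW => /(n_out _ _ wA uA)/andP[].
have sumS (f : V -> R) w : w \notin A ->
    (forall u, u \in A -> ~~ n w u -> f u = 0) ->
    \sum_(u in A) f u = \sum_(u in S) f u.
  move=> wA f0; apply: sum_subset => [|u].
    by apply/subsetP => u; rewrite !inE => /andP[/andP[]].
  rewrite in_setD => /andP[uS uA]; apply: f0 => //.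
  by apply: contra uS => /(n_out _ _ wA uA)/andP[].
have Nf w u : ~~ n w u -> (n w u)%:R = 0 :> R by move/negPf->.
have subS u : u \in S -> u \in A by rewrite !inE => /andP[/andP[]].
have subW w : w \in W -> w \notin A by rewrite !inE => /andP[].
have sumWS (f : V -> V -> R) : (forall w u, ~~ n w u -> f w u = 0) ->
    \sum_(w in ~: A) \sum_(u in A) f w u = \sum_(w in W) \sum_(u in S) f w u.
  move=> f0; under eq_bigr => w wA.
    rewrite (sumS _ w) => [|| u _ /f0 //]; last by rewrite inE in wA.
    over.
  rewrite exchange_big [RHS]exchange_big /=; apply: eq_bigr => u uS.
  by apply: (sumW _ u) => [|w _ /f0 //]; apply: subS.
apply: (@bipartite_bound _ _ S W n) => //.
  move=> u uS; have uA := subS _ uS.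
  move: (uS); rewrite inE => /andP[uAF uX]; apply: le_trans (hm u uAF uX) _.
  rewrite -(sumW _ u) // => [|w _ /Nf //].
  rewrite -natr_sum -big_mkcondr sum1dep_card ler_nat subset_leq_card //.
  by apply/subsetP => w; rewrite !inE => /andP[wA]; rewrite wA nE.
have := cross_sum_le sX eA hmu; rewrite -/(n _ _) => ub.
have -> : \sum_(w in W) \sum_(u in S) (n w u)%:R =
    \sum_(w in ~: A) \sum_(u in A) (n w u)%:R :> R by rewrite sumWS.
apply: le_trans ub; rewrite -/n (sumWS (fun w u => (n w u)%:R * _)).
  rewrite le_eqVlt; apply/orP; left; apply/eqP.
  apply: eq_bigr => w wW; apply: eq_bigr => u uS; have uA := subS _ uS.
  have wA := subW _ wW.
  by rewrite (sumW _ u uA) ?(sumS _ w wA) // => v _ /Nf.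
by move=> w u /Nf ->; rewrite mul0r.
Qed.

(** * Pure complexes and the downward induction *)

Lemma min_degree_le (V : finType) (X : {set {set V}}) j (F : {set V}) :
  F \in faces X j -> (min_degree X j <= degree X F)%N.
Proof.
move=> FX; rewrite /min_degree.
have : F \in index_enum {set V} by rewrite mem_index_enum.
elim: (index_enum _) => //= G r IHr; rewrite inE big_cons => /predU1P[<-|/IHr].
  by rewrite FX geq_minl.
by case: ifP => // _; apply: leq_trans; apply: geq_minr.
Qed.

Lemma min_degree_gt0 (V : finType) (X : {set {set V}}) j :
  (0 < #|V|)%N -> (forall F, F \in faces X j -> (0 < degree X F)%N) ->
  (0 < min_degree X j)%N.
Proof.
move=> V0 dX; rewrite /min_degree; elim/big_ind: _ => // a b a0 b0.
by rewrite leq_min a0.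
Qed.

Lemma pure_facet (V : finType) (X : {set {set V}}) d :
  pure_of_dim X d -> exists2 G, G \in X & #|G| = d.+1.
Proof.
case=> dimX _; have [X0|X0] := posnP #|X|.
  by move: dimX; rewrite /has_dim (cards0_eq X0) big_set0.
have [F FX cF] := eq_bigmax_cond (fun F : {set V} => #|F|) X0.
by exists F; rewrite // -cF.
Qed.

Lemma pure_max_face (V : finType) (X : {set {set V}}) d (G : {set V}) :
  pure_of_dim X d -> G \in X -> (#|G| == d.+1) = maximal_face X G.
Proof.
move=> [dimX pX] GX; apply/eqP/idP => [cG|/pX//].
apply/maxsetP; split=> [|H HX GH]; first exact: GX.
apply/esym/eqP; rewrite eqEcard GH cG -dimX.
by have /bigmax_leqP := leqnn (\max_(F in X) #|F|); apply.
Qed.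

Lemma pure_face_extend (V : finType) (X : {set {set V}}) d (F : {set V}) :
  simplicial_complex X -> pure_of_dim X d -> F \in X -> (#|F| <= d)%N ->
  exists2 v, v \notin F & v |: F \in X.
Proof.
move=> [Xsub _] [_ pX] FX cF; have [G mG FG] := maxset_exists (P := mem X) FX.
have cG := pX G mG; have [GX _] := maxsetP mG.
have /properP[_ [v vG vF]] : F \proper G by rewrite properEcard FG cG ltnS.
by exists v => //; apply: Xsub GX _; rewrite subUset sub1set vG.
Qed.

Lemma pure_degree_gt0 (V : finType) (X : {set {set V}}) d (F : {set V}) :
  simplicial_complex X -> pure_of_dim X d -> F \in X -> (#|F| <= d)%N ->
  (0 < degree X F)%N.
Proof.
move=> sX pX FX cF; have [v vF vX] := pure_face_extend sX pX FX cF.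
by rewrite degreeE card_gt0; apply/set0Pn; exists v; rewrite !inE vF.
Qed.

Lemma small_independent (V : finType) (X : {set {set V}}) d (A : {set V}) :
  pure_of_dim X d -> (#|A| <= d)%N -> independent X A.
Proof.
move=> [_ pX] cA; apply/forall_inP => G /pX cG; apply/negP => /subset_leq_card.
by rewrite cG leqNgt ltnS cA.
Qed.

(** Indexed by cardinality: a lower bound for the degree of the faces with i
    vertices.  The empty face has degree #|V|, so that the factor n of the
    bound fits the same recursion as the others. *)
Definition min_degree_shift (V : finType) (X : {set {set V}}) (i : nat) : nat :=
  if i is j.+1 then min_degree X j else #|V|.

Lemma min_degree_shift_le (V : finType) (X : {set {set V}}) (F : {set V}) :
  simplicial_complex X -> F \in X -> (min_degree_shift X #|F| <= degree X F)%N.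
Proof.
move=> [_ X1] FX; case cF : #|F| => [|j] /=.
  rewrite (cards0_eq cF) degreeE -cardsT subset_leq_card //.
  by apply/subsetP => v _; rewrite !inE setU0 X1.
by apply: min_degree_le; rewrite inE FX cF /=.
Qed.

(** Downward induction on the cardinality d - k of F.  Positivity of mu and c is
    carried along because each step divides by an eigenvalue, whose positivity
    comes from the step inequality itself: its left-hand side is positive. *)
Lemma outdegree_ge (R : realType) (V : finType) (X : {set {set V}}) (d : nat)
    (mu : nat -> R) (c : nat -> R) :
  simplicial_complex X -> pure_of_dim X d ->
  (forall j, (j < d)%N -> largest_laplacian_eigenvalue X j (mu j)) ->
  c d = (min_degree_shift X d)%:R ->
  (forall i, (i < d)%N ->
     c i = (min_degree_shift X i + i)%:R / mu i * c i.+1) ->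
  forall k, (k <= d)%N ->
  [/\ forall i, (d - k <= i < d)%N -> 0 < mu i, 0 < c (d - k)%N &
  forall A F, independent X A -> F \in X -> F \subset A -> #|F| = (d - k)%N ->
    c (d - k)%N <= (outdegree X A F)%:R].
Proof.
move=> sX pX hmu c_top c_rec.
have [G0 G0X cG0] := pure_facet pX.
have V0 : (0 < #|V|)%N by apply: leq_trans (max_card (mem G0)); rewrite cG0.
have Dsh i : (i <= d)%N -> (0 < min_degree_shift X i)%N.
  case: i => [|j] //= jd; apply: min_degree_gt0 => // F; rewrite inE => /andP[FX /eqP cF].
  by apply: (pure_degree_gt0 sX pX FX); rewrite cF.
elim=> [_|k IHk kd].
  rewrite subn0 c_top; split=> [i||A F iA FX FA cF].
  - by rewrite ltnNge => /andP[->].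
  - by rewrite ltr0n Dsh.
  - rewrite ler_nat -{1}cF (leq_trans (min_degree_shift_le sX FX)) //.
    rewrite (degree_split X FA) (_ : [set u in _ | _] = set0) ?cards0 //.
    apply/setP => u; rewrite !inE; apply/negP => /andP[/andP[uF uA] uX].
    have := forall_inP iA (u |: F); rewrite -(pure_max_face pX uX) cardsU1 uF cF eqxx.
    by move=> /(_ isT); rewrite subUset sub1set uA FA.
have [mu0 c0 IH] := IHk (ltnW kd); set i := (d - k.+1)%N.
have iS : (d - k)%N = i.+1 by rewrite /i subnSK.
have id : (i < d)%N by rewrite /i; lia.
rewrite iS in mu0 c0 IH.
have step A F : independent X A -> F \in X -> F \subset A -> #|F| = i ->
    (degree X F + i)%:R * c i.+1 <= mu i * (outdegree X A F)%:R.
  move=> iA FX FA cF.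
  wlog S0 : A iA FA / [set u in A :\: F | u |: F \in X] != set0 => [wl|].
    have [S0|S0] := eqVneq [set u in A :\: F | u |: F \in X] set0; last exact: wl.
    have [|v vF vX] := pure_face_extend sX pX FX; first by rewrite cF ltnW.
    have vFA : F \subset v |: F by apply: subsetUr.
    (* With no vertex of A available, enlarge F by v instead: the small set
       v |: F is independent, and its outdegree does not exceed that of A. *)
    have le_v : (degree X F + i)%:R * c i.+1 <= mu i * (outdegree X (v |: F) F)%:R.
      apply: wl => //; last first.
        by apply/set0Pn; exists v; rewrite !inE vF eqxx vX.
      by apply: (small_independent pX); rewrite cardsU1 vF cF.
    apply: le_trans le_v _; rewrite ler_wpM2l ?ler_nat //.
      by apply: eigenvalue_ge0 sX _; apply: (hmu i id).1.
    have := degree_split X FA; rewrite S0 cards0 add0n => <-.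
    by rewrite (degree_split X vFA) leq_addl.
  have st := @outdegree_step R V X A F (mu i) (c i.+1) sX FA.
  rewrite cF in st; apply: st => //; first exact: hmu.
  move=> u; rewrite inE => /andP[uF uA] uX; apply: IH => //.
    by rewrite subUset sub1set uA.
  by rewrite cardsU1 uF cF.
have deg_c F : F \in X -> #|F| = i -> 0 < (degree X F + i)%:R * c i.+1.
  move=> FX cF; rewrite mulr_gt0 // ltr0n addn_gt0.
  by rewrite (pure_degree_gt0 sX pX) // cF ltnW.
have [F0 F0X cF0] : exists2 F, F \in X & #|F| = i.
  exists [set v in take i (enum G0)].
    apply: (sX.1) G0X _; apply/subsetP => v.
    by rewrite inE => /mem_take; rewrite mem_enum.
  rewrite cardsE (card_uniqP (take_uniq i (enum_uniq _))) size_takel //.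
  by rewrite -cardE cG0 ltnW // ltnS ltnW.
have mui : 0 < mu i.
  have F0i : independent X F0 by apply: (small_independent pX); rewrite cF0 ltnW.
  have pos := lt_le_trans (deg_c F0 F0X cF0) (step F0 F0 F0i F0X (subxx _) cF0).
  have mu_ge0 : 0 <= mu i by apply: eigenvalue_ge0 sX _; apply: (hmu i id).1.
  by rewrite lt0r mu_ge0 andbT; apply: contraTneq pos => ->; rewrite mul0r ltxx.
have c_i := c_rec i id; split.
- move=> l /andP[]; rewrite leq_eqVlt => /predU1P[<- //|il ld].
  by apply: mu0; rewrite il.
- rewrite c_i mulr_gt0 ?divr_gt0 // ltr0n addn_gt0 Dsh //; exact: ltnW.
move=> A F iA FX FA cF; rewrite c_i mulrAC ler_pdivrMr // [_ * mu i]mulrC.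
apply: le_trans (step A F iA FX FA cF); rewrite ler_wpM2r ?(ltW c0) //.
by rewrite ler_nat leq_add2r -cF min_degree_shift_le.
Qed.

(** * Independence number and chromatic number *)

(** Here n is the number of vertices, a the independence number and k the number
    of colours; a > 0 ensures that the denominator is positive. *)
Lemma ratio_of_average (R : realFieldType) (M K n k a : R) :
  0 < M -> 0 < n -> 0 < a -> a <= (M - K) / M * n -> n <= k * a -> 0 <= k ->
  M / (M - K) <= k.
Proof.
move=> M0 n0 a0 le_a le_n k0.
have MK0 : 0 < M - K.
  by have := lt_le_trans a0 le_a; rewrite pmulr_lgt0 // pmulr_lgt0 ?invr_gt0.
rewrite ler_pdivrMr // -(ler_pM2r n0).
have : n * M <= k * ((M - K) / M * n) * M.
  by rewrite ler_wpM2r ?(ltW M0) // (le_trans le_n) // ler_wpM2l.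
by rewrite mulrC [X in _ <= X -> _](_ : _ = k * (M - K) * n) //; field; rewrite gt_eqF.
Qed.

(** The chain of bounds applied to the empty face, whose outdegree is the number
    of vertices outside A. *)
Lemma independent_set_bound (R : realType) (V : finType) (X : {set {set V}}) (d : nat)
    (mu : nat -> R) (A : {set V}) :
  (1 <= d)%N -> simplicial_complex X -> X != set0 -> pure_of_dim X d ->
  (forall j : nat, (j < d)%N -> largest_laplacian_eigenvalue X j (mu j)) ->
  independent X A ->
  let M : R := \prod_(j < d) mu j in
  let K : R := (min_degree X d.-1)%:R *
               \prod_(i < d.-1) (min_degree X i + i + 1)%:R in
  0 < M /\ #|A|%:R <= (M - K) / M * #|V|%:R.
Proof.
move=> hd sX X0 pX hmu iA M K.
pose c i : R := (min_degree X d.-1)%:R *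
  \prod_(i <= l < d) ((min_degree_shift X l + l)%:R / mu l).
have c_top : c d = (min_degree_shift X d)%:R.
  by rewrite /c big_geq // mulr1; case: (d) hd.
have c_rec i : (i < d)%N -> c i = (min_degree_shift X i + i)%:R / mu i * c i.+1.
  by move=> id; rewrite /c big_ltn // mulrCA.
have [] := outdegree_ge sX pX hmu c_top c_rec (leqnn d); rewrite subnn => mu0 _ le_c.
have M0 : 0 < M by apply: prodr_gt0 => i _; apply: mu0 => /=.
split=> //.
have X_0 : set0 \in X.
  by have [F FX] := set0Pn _ X0; apply: (sX.1) FX (sub0set _).
have := le_c A set0 iA X_0 (sub0set _) (cards0 _).
have -> : outdegree X A set0 = #|~: A|.
  by apply: eq_card => v; rewrite !inE setU0 (sX.2) andbT.
have -> : c 0%N = K / M * #|V|%:R.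
  have num : \prod_(0 <= l < d) (min_degree_shift X l + l)%:R =
      #|V|%:R * \prod_(i < d.-1) (min_degree X i + i + 1)%:R :> R.
    case: (d) hd => // d' _; rewrite big_nat_recl // big_mkord /= addn0.
    by congr (_ * _); apply: eq_bigr => i _; rewrite addn1 addnS.
  rewrite /c prodf_div num big_mkord -/M /K; ring.
have -> : #|V|%:R = #|A|%:R + #|~: A|%:R :> R by rewrite -natrD cardsC.
move: (#|A|%:R : R) (#|~: A|%:R : R) => a b; rewrite mulrBl divff ?gt_eqF // mulrBl mul1r.
by move=> h; rewrite lerBrDr lerD2l.
Qed.

Theorem theorem1p2 (R : realType) (V : finType) (X : {set {set V}}) (d : nat)
    (hd : (1 <= d)%N)
    (hX : simplicial_complex X)
    (hX0 : X != set0)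
    (hpure : pure_of_dim X d)
    (mu : nat -> R)
    (hmu : forall j : nat, (j < d)%N -> largest_laplacian_eigenvalue X j (mu j)) :
  let M : R := \prod_(j < d) mu j in
  let K : R := (min_degree X d.-1)%:R *
               \prod_(i < d.-1) (min_degree X i + i + 1)%:R in
  (independence_number X)%:R <= (M - K) / M * #|V|%:R /\
  M / (M - K) <= (chromatic_number X)%:R.
Proof.
move=> M K.
have bound A : independent X A -> 0 < M /\ #|A|%:R <= (M - K) / M * #|V|%:R.
  exact: independent_set_bound.
have i0 : independent X set0 by apply: (small_independent hpure); rewrite cards0.
have M0 := (bound _ i0).1.
have [B iB alphaE] : exists2 B, independent X B & independence_number X = #|B|.
  have [|B iB BE] := eq_bigmax_cond (fun B : {set V} => #|B|) (A := independent X).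
    by apply/card_gt0P; exists set0.
  by exists B; rewrite // -BE.
have alpha_le : (independence_number X)%:R <= (M - K) / M * #|V|%:R.
  by rewrite alphaE; apply: (bound _ iB).2.
split=> //.
have [v _] : exists v : V, true.
  have [G _ cG] := pure_facet hpure.
  by have /card_gt0P[v _] : (0 < #|G|)%N by [rewrite cG]; exists v.
have alpha_gt0 : (0 < independence_number X)%N.
  have := @leq_bigmax_cond _ (independent X) (fun B => #|B|) [set v].
  rewrite cards1; apply; apply: (small_independent hpure); by rewrite cards1.
have V0 : (0 < #|V|)%N by apply/card_gt0P; exists v.
have le_col k : (#|V| <= k * independence_number X)%N -> M / (M - K) <= k%:R.
  move=> le_n; pose a : R := (independence_number X)%:R.
  apply: (@ratio_of_average _ M K #|V|%:R _ a) => //.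
  - by rewrite ltr0n.
  - by rewrite ltr0n.
  - by rewrite -natrM ler_nat.
rewrite /chromatic_number; elim/big_ind: _.
- by apply: le_col; rewrite leq_pmulr.
- by move=> a b ha hb; rewrite /minn; case: ifP.
- move=> P /andP[partP /forall_inP colP].
  apply: le_col; rewrite -cardsT (card_partition partP) -sum_nat_const.
  apply: leq_sum => A AP.
  exact: (@leq_bigmax_cond _ (independent X) (fun B => #|B|) A (colP A AP)).
Qed.
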